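(* Let $X=\{X_t,\ t\ge0\}$ be a subordinator without drift and with moments of all orders, let $T>0$, $n\ge1$ and $r_1,\dots,r_n\ge1$. Then for every $f\in L^2_n$, $$I_n^{(r_1,\dots,r_n)}(f)=\int_{[0,T]^n}f\,dm_{r_1,\dots,r_n}\qquad\text{a.s.}$$
   Context: $(\Omega,\mathcal F,\mathbb P)$ is a complete probability space. A subordinator is a real Lévy process (stationary independent increments, continuous in probability, cadlag, $X_0=0$) with increasing paths; it can be written $X_t=\gamma_0t+\sum_{0<s\le t}\Delta X_s$ with $\gamma_0\ge0$, and ''without drift'' means $\gamma_0=0$. The measure $m_{r_1,\dots,r_n}$. Let $\{T_k,\ k\ge1\}$ be a sequence of stopping times with disjoint graphs that exhausts the jumps of $X$ ($\Delta X_{T_k}\ne0$ for all $k$ with $T_k<\infty$, and $X$ jumps only at these times). $J_n$ is the (random) set of $n$-tuples $(T_{i_1},\dots,T_{i_n})$ with all $T_{i_j}\le T$ and all entries different. The random (pathwise) measure on $[0,T]^n$ is $$m_{r_1,\dots,r_n}=\sum_{(T_{i_1},\dots,T_{i_n})\in J_n}(\Delta X_{T_{i_1}})^{r_1}\cdots(\Delta X_{T_{i_n}})^{r_n}\,\delta_{(T_{i_1},\dots,T_{i_n})},$$ with $\delta_a$ the Dirac measure at $a$ and the sum being $0$ if $J_n=\varnothing$. The multiple Itô integral. For a subordinator without drift, set $X^{(n)}_t=\sum_{0<s\le t}(\Delta X_s)^n$, $n\ge1$ (so $X^{(1)}=X$), and let $\phi_n$ be the $\sigma$-additive $L^2(\Omega)$-valued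 measure on $\mathcal B([0,T])$ with $\phi_n((s,t])=X^{(n)}_t-X^{(n)}_s$, $\phi_n(\{0\})=0$. $L^2_n=L^2([0,T]^n,\mathcal B([0,T]^n),(dt)^{\otimes n})$. For $f=\sum_{i_1,\dots,i_n=1}^m a_{i_1,\dots,i_n}\mathbf 1_{A_{i_1}\times\cdots\times A_{i_n}}$ with $A_1,\dots,A_m\in\mathcal B([0,T])$ pairwise disjoint and $a_{i_1,\dots,i_n}=0$ whenever two indices are equal, $I_n^{(r_1,\dots,r_n)}(f)=\sum a_{i_1,\dots,i_n}\phi_{r_1}(A_{i_1})\cdots\phi_{r_n}(A_{i_n})$; this extends uniquely to a continuous linear map $I_n^{(r_1,\dots,r_n)}:L^2_n\to L^2(\Omega)$. *)

(* Defs.v *)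
From HB Require Import structures.
From mathcomp Require Import all_boot all_order all_algebra.
From mathcomp Require Import all_classical all_reals all_analysis.

Set Implicit Arguments.
Unset Strict Implicit.
Unset Printing Implicit Defensive.

Import Order.TTheory GRing.Theory Num.Theory.
Import numFieldNormedType.Exports.

Local Open Scope classical_set_scope.
Local Open Scope ring_scope.

(* Product of mu on T and nu on T^n, transported to T^(n+1) along
   (x, t) |-> x :: t *)
Section cons_measure.
Context d (T : measurableType d) (R : realType) (n : nat).
Variables (mu : {finite_measure set T -> \bar R})
  (nu : {finite_measure set (n.-tuple T) -> \bar R}).

Definition consp (p : T * n.-tuple T) : n.+1.-tuple T :=
  [the n.+1.-tuple T of p.1 :: p.2].

Lemma measurable_consp : measurable_fun setT consp.
Proof. exact: measurable_cons. Qed.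

Definition cons_measure : set (n.+1.-tuple T) -> \bar R :=
  pushforward (mu \x nu)%E consp.

Let cons_measure0 : cons_measure set0 = 0%E.
Proof. by rewrite /cons_measure /pushforward preimage_set0 measure0. Qed.

Let cons_measure_ge0 A : (0 <= cons_measure A)%E.
Proof. exact: (measure_ge0 (mu \x nu)%E). Qed.

Let cons_measure_sigma_additive : semi_sigma_additive cons_measure.
Proof.
move=> F mF tF mUF; rewrite /cons_measure /pushforward preimage_bigcup.
have mc A : measurable A -> measurable (consp @^-1` A).
  by move=> mA; rewrite -[X in measurable X]setTI; exact: measurable_consp.
apply: measure_semi_sigma_additive.
- by move=> k; exact: mc.
- apply/trivIsetP => /= i j _ _ ij; rewrite -preimage_setI.
  by move/trivIsetP : tF => /(_ _ _ _ _ ij) ->//; rewrite preimage_set0.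
- by rewrite -preimage_bigcup; exact: mc.
Qed.

HB.instance Definition _ := isMeasure.Build _ _ _ cons_measure
  cons_measure0 cons_measure_ge0 cons_measure_sigma_additive.

Let cons_measure_fin : fin_num_fun cons_measure.
Proof.
move=> A mA; rewrite ge0_fin_numE; last exact: measure_ge0.
rewrite /cons_measure /pushforward.
apply: (@le_lt_trans _ _ ((mu \x nu)%E (setT `*` setT))).
  rewrite setXTT; apply: le_measure; rewrite ?inE//.
  by rewrite -[X in measurable X]setTI; exact: measurable_consp.
by rewrite product_measure1E// lte_mul_pinfty// ?fin_num_measure// ltey_eq
  fin_num_measure.
Qed.

HB.instance Definition _ :=
  Measure_isFinite.Build _ _ _ cons_measure cons_measure_fin.

End cons_measure.

Fixpoint tuple_measure d (T : measurableType d) (R : realType)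
    (mu : {finite_measure set T -> \bar R}) (n : nat) :
    {finite_measure set (n.-tuple T) -> \bar R} :=
  match n with
  | 0%N => [the {finite_measure set (0.-tuple T) -> \bar R} of
              dirac [tuple of nil]]
  | n'.+1 => [the {finite_measure set (n'.+1.-tuple T) -> \bar R} of
              cons_measure mu (tuple_measure mu n')]
  end.

Definition box (T : Type) (n : nat) (A : 'I_n -> set T) : set (n.-tuple T) :=
  [set x | forall j, A j (tnth x j)].

Lemma tuple_measure_box d (T : measurableType d) (R : realType)
    (mu : {finite_measure set T -> \bar R}) (n : nat) (A : 'I_n -> set T) :
  (forall j, measurable (A j)) ->
  measurable (box A) /\
  tuple_measure mu n (box A) = (\prod_(j < n) mu (A j))%E.
Proof.
elim: n A => [|n IH] A mA.
  have -> : box A = setT by apply/seteqP; split => // x _ [].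
  by split=> //=; rewrite big_ord0 diracT.
have [mB EB] := IH (A \o lift ord0) (fun j => mA _).
have mbox : measurable (box A).
  rewrite (_ : box A = \bigcap_(j in [set: 'I_n.+1])
      ((fun x : n.+1.-tuple T => tnth x j) @^-1` A j)); last first.
    by apply/seteqP; split => x /=; [move=> Ax j _; exact: Ax|move=> Ax j; exact: Ax].
  apply: fin_bigcap_measurable => // j _.
  rewrite -[X in measurable X]setTI; exact: measurable_tnth.
split=> //=; rewrite /cons_measure /pushforward.
rewrite (_ : _ @^-1` _ = A ord0 `*` box (A \o lift ord0)).
  rewrite big_ord_recl -EB.
  exact: (product_measure1E mu (tuple_measure mu n) (mA ord0) mB).
apply/seteqP; split => -[x t] /= => [Axt|[Ax At] j].
  split; first by have := Axt ord0.
  by move=> j /=; have := Axt (lift ord0 j); rewrite tnthS.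
have [->//|j0] := eqVneq j ord0.
have [k ->] : exists k, j = lift ord0 k.
  by case: (unliftP ord0 j) j0 => [k ->|->]; [exists k|rewrite eqxx].
by rewrite tnthS; exact: At.
Qed.

Section levy.
Context d (Omega : measurableType d) (R : realType).
Variables (P : probability Omega R) (X : R -> {RV P >-> R}).

Definition mutually_independent (k : nat) (Y : 'I_k -> Omega -> R) :=
  forall B : 'I_k -> set R, (forall i, measurable (B i)) ->
    P (\bigcap_(i in [set: 'I_k]) (Y i @^-1` B i)) =
    (\prod_(i < k) P (Y i @^-1` B i))%E.

Definition incr (s t : R) : Omega -> R := fun w => X t w - X s w.

Definition stationary_increments :=
  forall s h : R, 0 <= s -> 0 <= h -> forall B : set R, measurable B ->
    P (incr s (s + h) @^-1` B) = P (incr 0 h @^-1` B).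

Definition independent_increments :=
  forall (k : nat) (t : nat -> R), 0 <= t 0%N ->
    (forall i, (i < k)%N -> t i <= t i.+1) ->
    mutually_independent (fun i : 'I_k => incr (t i) (t i.+1)).

Definition continuous_in_probability :=
  forall t e : R, 0 <= t -> 0 < e ->
    P [set w | e < `|X s w - X t w|]
      @[s --> within [set s | 0 <= s] (nbhs t)] --> (0 : \bar R).

Definition cadlag (x : R -> R) :=
  (forall t : R, 0 <= t -> x s @[s --> t^'+] --> x t) /\
  (forall t : R, 0 < t -> cvg (x s @[s --> t^'-])).

(* Processes are indexed by t >= 0; the values X t for t < 0 are never used. *)
Record levy_process : Prop := LevyProcess {
  levy_stationary : stationary_increments ;
  levy_independent : independent_increments ;
  levy_continuous : continuous_in_probability ;
  levy_cadlag : forall w, cadlag (X ^~ w) ;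
  levy_init : forall w, X 0 w = 0 }.

Record subordinator : Prop := Subordinator {
  subordinator_levy : levy_process ;
  subordinator_incr : forall w (s t : R), 0 <= s -> s <= t -> X s w <= X t w }.

Definition moments_of_all_orders :=
  forall (t : R) (p : nat), 0 <= t ->
    P.-integrable setT (fun w => (X t w ^+ p)%:E).

End levy.

Section jumps.
Context (R : realType).

(* x t - x t-, with the convention x 0- = x 0 *)
Definition jump (x : R -> R) (t : R) : R :=
  if 0 < t then x t - lim (x s @[s --> t^'-]) else 0.

Definition jump_tuples (T : R) (n : nat) (tau : nat -> \bar R) :
    set (n.-tuple R) :=
  [set t : n.-tuple R | uniq t /\
    forall j, tnth t j <= T /\ exists k, tau k = (tnth t j)%:E].
Arguments jump_tuples T n tau : clear implicits.

(* \esum is a sum only for nonnegative terms, which is the case for increasing x. *)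
Definition jump_measure (x : R -> R) (tau : nat -> \bar R) (T : R) (n : nat)
    (r : 'I_n -> nat) : set (n.-tuple R) -> \bar R :=
  fun A => (\esum_(t in jump_tuples T n tau)
    ((\prod_(j < n) jump x (tnth t j) ^+ r j)%:E * \d_t A))%E.

Lemma jump_ge0 (x : R -> R) t : cadlag x ->
  (forall s u : R, 0 <= s -> s <= u -> x s <= x u) -> 0 <= jump x t.
Proof.
move=> [_ xl] xnd; rewrite /jump; case: ifPn => // t0; rewrite subr_ge0.
apply: limr_le; first exact: xl.
near=> s; apply: xnd; last by near: s; exact: nbhs_left_le.
by near: s; exact: nbhs_left_ge.
Unshelve. all: by end_near. Qed.

Lemma jump_measure_semi_sigma_additive (x : R -> R) tau T n (r : 'I_n -> nat) :
  cadlag x -> (forall s u : R, 0 <= s -> s <= u -> x s <= x u) ->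
  semi_sigma_additive (jump_measure x tau T r).
Proof.
move=> cx xnd F mF tF mUF.
have c0 t : (0 <= (\prod_(j < n) jump x (tnth t j) ^+ r j)%:E)%E.
  by rewrite lee_fin prodr_ge0// => j _; rewrite exprn_ge0// jump_ge0.
have d0 t A : (0 <= (\prod_(j < n) jump x (tnth t j) ^+ r j)%:E * \d_t A)%E.
  by rewrite mule_ge0.
have m0 A : (0 <= jump_measure x tau T r A)%E by apply: esum_ge0 => t _.
rewrite [X in _ --> X](_ : _ =
    (\sum_(0 <= k <oo) jump_measure x tau T r (F k))%E); last first.
  rewrite nneseries_esumT//.
  transitivity (\esum_(t in jump_tuples T n tau) \esum_(k in [set: nat])
      ((\prod_(j < n) jump x (tnth t j) ^+ r j)%:E * \d_t (F k)))%E.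
    apply: eq_esum => t _.
    by rewrite -nneseries_esumT// measure_semi_bigcup// nneseriesZl.
  rewrite /jump_measure !esum_esum//.
  apply: (@reindex_esum _ _ _ _ _ (fun p => (p.2, p.1))); split.
  - by move=> [k t] [].
  - by move=> [k t] [k' t'] _ _ [-> ->].
  - by move=> [t k] [tJ _]; exists (k, t).
exact: is_cvg_nneseries.
Qed.

End jumps.

Section stopping.
Context d (Omega : measurableType d) (R : realType).
Variables (P : probability Omega R) (X : R -> {RV P >-> R}).

Record filtration (F : R -> set (set Omega)) : Prop := Filtration {
  filtration_sigma : forall t : R, 0 <= t -> sigma_algebra setT (F t) ;
  filtration_sub : forall t : R, 0 <= t -> F t `<=` measurable ;
  filtration_mono : forall s t : R, 0 <= s -> s <= t -> F s `<=` F t }.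

Definition adapted (F : R -> set (set Omega)) :=
  forall t : R, 0 <= t -> forall B : set R, measurable B -> F t (X t @^-1` B).

Definition stopping_time (F : R -> set (set Omega)) (tau : Omega -> \bar R) :=
  (forall w, 0 <= tau w)%E /\
  (forall t : R, 0 <= t -> F t [set w | tau w <= t%:E]%E).

Definition disjoint_graphs (tau : nat -> Omega -> \bar R) :=
  forall i j w (t : R), tau i w = t%:E -> tau j w = t%:E -> i = j.

Definition exhausts_jumps (tau : nat -> Omega -> \bar R) :=
  forall w,
    (forall k t, tau k w = t%:E -> jump (X ^~ w) t != 0) /\
    (forall t : R, 0 <= t -> jump (X ^~ w) t != 0 -> exists k, tau k w = t%:E).

Definition is_drift (gamma : R) :=
  0 <= gamma /\
  {ae P, forall w, forall t : R, 0 <= t ->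
    (X t w)%:E =
    ((gamma * t)%:E + \esum_(s in `]0%R, t]) (jump (X ^~ w) s)%:E)%E}.

(* The sum is finite along increasing paths. *)
Definition power_jump (k : nat) (t : R) : Omega -> R :=
  fun w => fine (\esum_(s in `]0%R, t]) (jump (X ^~ w) s ^+ k)%:E)%E.

Definition L2_cvg (u : nat -> Omega -> R) (v : Omega -> R) :=
  'N[P]_2%:E[EFin \o (u k \- v)%R]%E @[k --> \oo] --> (0 : \bar R).

(* phi A matters only for Borel subsets A of [0, T]. *)
Record jump_L2_measure (T : R) (k : nat) (phi : set R -> Omega -> R) : Prop :=
  JumpL2Measure {
  jump_L2 : forall A : set R, measurable A -> A `<=` `[0, T] ->
    phi A \in Lfun P 2%:E ;
  jump_L2_sigma_additive : forall A : nat -> set R,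
    (forall i, measurable (A i)) -> (forall i, A i `<=` `[0, T]) ->
    trivIset setT A ->
    L2_cvg (fun N w => \sum_(i < N) phi (A i) w) (phi (\bigcup_i A i)) ;
  jump_L2_itv : forall s t : R, 0 <= s -> s <= t -> t <= T ->
    phi [set` `]s, t]] = power_jump k t \- power_jump k s %[ae P] ;
  jump_L2_0 : phi [set 0] = (fun=> 0) %[ae P] }.

End stopping.

Section leb.
Context (R : realType) (T : R).

Definition leb1 (A : set R) : \bar R := lebesgue_measure (A `&` `[0, T]).

Let leb10 : leb1 set0 = 0%E. Proof. by rewrite /leb1 set0I measure0. Qed.

Let leb1_ge0 A : (0 <= leb1 A)%E.
Proof. exact: (measure_ge0 (@lebesgue_measure R)). Qed.

Let leb1_sigma_additive : semi_sigma_additive leb1.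
Proof.
have mI : measurable (`[0, T] : set (measurableTypeR R)).
  exact: measurable_itv.
move=> F mF tF mUF.
exact: (@measure_semi_sigma_additive _ _ _ (mrestr (@lebesgue_measure R) mI)).
Qed.

HB.instance Definition _ := isMeasure.Build _ _ _ leb1
  leb10 leb1_ge0 leb1_sigma_additive.

Let leb1_fin : fin_num_fun leb1.
Proof.
move=> A mA; rewrite ge0_fin_numE//.
apply: (@le_lt_trans _ _ (@lebesgue_measure R `[0, T])).
  by apply: le_measure; rewrite ?inE//; apply: measurableI => //;
    exact: measurable_itv.
by rewrite lebesgue_measure_itv/=; case: ifPn => // _; rewrite ltry.
Qed.

HB.instance Definition _ := Measure_isFinite.Build _ _ _ leb1 leb1_fin.

(* (dt)^n on [0, T]^n, seen as a measure on R^n concentrated on [0, T]^n, so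
   that L^2([0, T]^n) is Lfun (leb T n) 2: values off [0, T]^n are irrelevant. *)
Definition leb (n : nat) := tuple_measure leb1 n.

Definition cube (n : nat) : set (n.-tuple R) := box (fun=> `[0, T]%classic).

End leb.
Arguments cube {R} T n.

Section multiple_integral.
Context d (Omega : measurableType d) (R : realType).
Variables (P : probability Omega R) (T : R) (n : nat).

Definition elementary (m : nat) (A : 'I_m -> set R)
    (a : n.-tuple 'I_m -> R) : n.-tuple R -> R :=
  fun x => \sum_(i : n.-tuple 'I_m)
    a i * \1_(box (fun j => A (tnth i j))) x.

Definition elementary_integral (phi : nat -> set R -> Omega -> R)
    (r : 'I_n -> nat) (m : nat) (A : 'I_m -> set R)
    (a : n.-tuple 'I_m -> R) : Omega -> R :=
  fun w => \sum_(i : n.-tuple 'I_m)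
    a i * \prod_(j < n) phi (r j) (A (tnth i j)) w.

(* A continuous linear map L^2([0, T]^n) -> L^2(P), given on representatives,
   that has the prescribed values on elementary functions. *)
Record multiple_ito_integral (phi : nat -> set R -> Omega -> R)
    (r : 'I_n -> nat) (I : (n.-tuple R -> R) -> Omega -> R) : Prop :=
  MultipleItoIntegral {
  ito_L2 : forall f : n.-tuple R -> R, f \in Lfun (leb T n) 2%:E ->
    I f \in Lfun P 2%:E ;
  ito_linear : forall (c : R) (f g : n.-tuple R -> R),
    f \in Lfun (leb T n) 2%:E -> g \in Lfun (leb T n) 2%:E ->
    I (fun x => c * f x + g x) = (fun w => c * I f w + I g w) %[ae P] ;
  ito_continuous : forall f : n.-tuple R -> R, f \in Lfun (leb T n) 2%:E ->
    forall e : R, 0 < e -> exists2 del : R, 0 < del &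
    forall g : n.-tuple R -> R, g \in Lfun (leb T n) 2%:E ->
      ('N[leb T n]_2%:E[EFin \o (g \- f)%R] < del%:E)%E ->
      ('N[P]_2%:E[EFin \o (I g \- I f)%R] < e%:E)%E ;
  ito_elementary : forall (m : nat) (A : 'I_m -> set R)
      (a : n.-tuple 'I_m -> R),
    (forall i, measurable (A i)) -> (forall i, A i `<=` `[0, T]) ->
    trivIset setT A -> (forall i : n.-tuple 'I_m, ~~ uniq i -> a i = 0) ->
    I (elementary A a) = elementary_integral phi r A a %[ae P] }.

End multiple_integral.

(* Main.v *)
(* By linearity and continuity of the multiple integral, the class of functions
   f with I f = \int f dm almost surely is closed under linear combinations and
   under limits in L^2(dt^n) along which the pathwise integrals converge as well:
   Fatou's lemma identifies an L^2(P) limit with an almost sure limit.  It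
   contains the indicators of boxes whose sides are pairwise disjoint intervals
   ]a, b], because distinct jump times are automatic in such a box and the sum
   over jump tuples factors.  Cutting an arbitrary box along a grid and keeping
   the products of distinct cells misses only a neighbourhood of the diagonals,
   which neither dt^n nor m charges; refining the grid puts every box in the
   class, Dynkin's theorem then every Borel set, and monotone approximation
   every f.  The continuity of I plays the role of moment estimates for m. *)

From HB Require Import structures.
Require Import Defs.
From mathcomp Require Import all_boot all_order all_algebra.
From mathcomp Require Import all_classical all_reals all_analysis.
From mathcomp Require Import measurable_realfun.

Set Implicit Arguments.
Unset Strict Implicit.
Unset Printing Implicit Defensive.

Import Order.TTheory GRing.Theory Num.Theory.
Import numFieldNormedType.Exports.
Import HBNNSimple.

Local Open Scope classical_set_scope.
Local Open Scope ring_scope.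

(** * Square-integrable functions and convergence in L^2 *)

Section square_integrable.
Context d (T : measurableType d) (R : realType).
Variable mu : {measure set T -> \bar R}.
Local Open Scope ereal_scope.

Lemma poweR_Lnorm2 (f : T -> R) :
  'N[mu]_2%:E[EFin \o f] `^ 2 = \int[mu]_x (f x ^+ 2)%:E.
Proof.
rewrite poweR_Lnorm//; apply: eq_integral => x _ /=.
by rewrite powR_mulrn// real_normK// num_real.
Qed.

Lemma Lnorm2_ltP (f : T -> R) (e : R) : (0 < e)%R ->
  ('N[mu]_2%:E[EFin \o f] < e%:E) = (\int[mu]_x (f x ^+ 2)%:E < (e ^+ 2)%:E).
Proof.
move=> e0; rewrite -poweR_Lnorm2.
have := Lnorm_ge0 mu 2%:E (EFin \o f).
case: ('N[mu]_2%:E[EFin \o f]) => [x| |]//=; last by rewrite pnatr_eq0.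
rewrite lee_fin => x0; rewrite !lte_fin powR_mulrn// ltr_pXn2r ?nnegrE//.
exact: ltW.
Qed.

Lemma Lfun2P (f : T -> R) :
  f \in Lfun mu 2%:E <->
  measurable_fun setT f /\ \int[mu]_x (f x ^+ 2)%:E < +oo.
Proof.
have key : ('N[mu]_2%:E[EFin \o f] < +oo) = (\int[mu]_x (f x ^+ 2)%:E < +oo).
  rewrite -poweR_Lnorm2; have := Lnorm_ge0 mu 2%:E (EFin \o f).
  by case: ('N[mu]_2%:E[EFin \o f]) => [x| |]//=; rewrite ?pnatr_eq0// !ltry.
split.
  rewrite inE => /andP[/[!inE]/= mf nf]; split=> //.
  by rewrite -key.
move=> [mf nf]; rewrite inE; apply/andP; split; rewrite inE//=.
by rewrite /finite_norm key.
Qed.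

Lemma Lfun2_lin (c : R) (f g : T -> R) :
  f \in Lfun mu 2%:E -> g \in Lfun mu 2%:E ->
  (fun x => c * f x + g x)%R \in Lfun mu 2%:E.
Proof.
move=> Lf Lg; have [_ addL] := Lfun_addr_closed mu (lee1n 2).
have Lcf : c \o* f \in Lfun mu 2%:E by apply: Lfun_scale => //; rewrite ler1n.
have -> : (fun x => c * f x + g x)%R = (c \o* f + g)%R.
  by apply/funext => x /=; rewrite mulrC.
exact: addL.
Qed.

Lemma le_Lfun2 (f g : T -> R) : measurable_fun setT f ->
  (forall x, `|f x| <= `|g x|)%R -> g \in Lfun mu 2%:E -> f \in Lfun mu 2%:E.
Proof.
move=> mf fg /Lfun2P[mg ig]; apply/Lfun2P; split => //.
apply: le_lt_trans ig; apply: ge0_le_integral => //.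
- by move=> x _; rewrite lee_fin sqr_ge0.
- by apply/measurable_EFinP; exact: measurable_funX.
- by apply/measurable_EFinP; exact: measurable_funX.
- move=> x _; rewrite lee_fin -[leLHS]real_normK ?num_real//.
  by rewrite -[leRHS]real_normK ?num_real// lerXn2r ?nnegrE.
Qed.

(* (u - v)^2 is bounded by 4 g^2 *)
Lemma dominated_Lnorm2 (u : nat -> T -> R) (v g : T -> R) :
  (forall k, measurable_fun setT (u k)) -> measurable_fun setT v ->
  g \in Lfun mu 2%:E -> (forall k x, `|u k x| <= g x)%R ->
  (forall x, `|v x| <= g x)%R ->
  {ae mu, forall x, u k x @[k --> \oo] --> v x} ->
  forall e : R, (0 < e)%R ->
    \forall k \near \oo, 'N[mu]_2%:E[EFin \o (u k \- v)%R] < e%:E.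
Proof.
move=> mu_ mv Lg ug vg uv e e0.
have [|||||_ _] := @dominated_convergence _ _ _ mu setT measurableT
  (fun k x => ((u k x - v x) ^+ 2)%:E) (fun=> 0)
  (fun x => (4 * g x ^+ 2)%:E).
- move=> k; apply/measurable_EFinP; apply: measurable_funX.
  exact: measurable_funB.
- exact: measurable_cst.
- apply: filterS uv => x uvx _; apply: cvg_EFin; first exact: nearW.
  have -> : 0%R = ((v x - v x) ^+ 2)%R :> R by rewrite subrr expr0n.
  rewrite expr2; under eq_fun do rewrite expr2.
  by apply: cvgM; apply: cvgB => //; exact: cvg_cst.
- have -> : (fun x => (4 * g x ^+ 2)%:E) = (fun x => 4%:E * (g x ^+ 2)%:E).
    by apply/funext => x; rewrite EFinM.
  by apply: integrableZl => //; exact: Lfun2_integrable_sqr.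
- apply: nearW => x k _ /=; rewrite lee_fin ger0_norm ?sqr_ge0//.
  have -> : (4 * g x ^+ 2 = (2 * g x) ^+ 2)%R.
    by rewrite exprMn -natrX.
  rewrite -[leLHS]real_normK ?num_real// lerXn2r ?nnegrE//.
    by rewrite mulr_ge0// (le_trans _ (vg x)).
  rewrite mulr_natl mulr2n (le_trans (ler_normB _ _))// lerD//.
rewrite integral0 => /= h.
have e20 : (0 < e ^+ 2)%R by rewrite exprn_gt0.
have h1 : ereal_nbhs 0 (fun u => u < (e ^+ 2)%:E).
  by apply: open_ereal_lt'; rewrite lte_fin.
have : \forall k \near \oo, \int[mu]_x ((u k x - v x) ^+ 2)%:E < (e ^+ 2)%:E.
  exact: (h _ h1).
by apply: filterS => k /=; rewrite Lnorm2_ltP.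
Qed.

(** By Fatou, the lower limit of [(u k - v)^2] has zero integral, hence vanishes almost everywhere;
    where [u k] tends to [z], that lower limit is [(z - v)^2]. The limit [z] may be infinite a
    priori, and the conclusion excludes it. *)
Lemma Lnorm2_cvg_unique (u : nat -> T -> R) (v : T -> R) (z : T -> \bar R) :
  (forall k, measurable_fun setT (u k)) -> measurable_fun setT v ->
  (forall e : R, (0 < e)%R ->
    \forall k \near \oo, 'N[mu]_2%:E[EFin \o (u k \- v)%R] < e%:E) ->
  {ae mu, forall x, (u k x)%:E @[k --> \oo] --> z x} ->
  {ae mu, forall x, (v x)%:E = z x}.
Proof.
move=> mu_ mv uv uz.
pose f k x := ((u k x - v x) ^+ 2)%:E.
have mf k : measurable_fun setT (f k).
  apply/measurable_EFinP; apply: measurable_funX.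
  exact: measurable_funB.
have f0 k x : 0 <= f k x by rewrite lee_fin sqr_ge0.
have if0 : (fun k => \int[mu]_x f k x) @ \oo --> 0.
  apply/fine_cvgP; split.
    have := uv _ ltr01; apply: filterS => k; rewrite Lnorm2_ltP// => fk.
    by rewrite ge0_fin_numE ?integral_ge0// (lt_trans fk)// ltry.
  apply/cvgrPdist_lt => e e0.
  (* [Lnorm2_ltP] squares the bound on the norm, so the norm is taken below the root of [e]. *)
  have se0 : (0 < Num.sqrt e)%R by rewrite sqrtr_gt0.
  have := uv _ se0; apply: filterS => k; rewrite Lnorm2_ltP//.
  rewrite sqr_sqrtr ?(ltW e0)// => fk; rewrite sub0r normrN.
  have f0k : 0 <= \int[mu]_x f k x by rewrite integral_ge0.
  rewrite ger0_norm ?fine_ge0// -lte_fin fineK//.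
  by rewrite ge0_fin_numE// (lt_trans fk)// ltry.
have := @fatou _ _ _ mu setT measurableT f mf (fun k x _ => f0 k x).
rewrite (cvg_limn_einf_sup if0).1 => h0.
pose h x := limn_einf (f ^~ x).
have hge0 x : 0 <= h x.
  rewrite /h limn_einf_lim; apply: lime_ge; first exact: is_cvg_einfs.
  by apply: nearW => k; apply: le_ereal_inf_tmp => _ [m _ <-].
have mh : measurable_fun setT h.
  (* A lower limit is by definition the opposite of the upper limit of the opposites. *)
  apply: measurableT_comp => //; apply: measurable_fun_limn_esup => k.
  exact: measurableT_comp.
have [+ _] := ae_eq_integral_abs mu measurableT mh.
under eq_integral do rewrite gee0_abs//.
have -> : \int[mu]_x h x = 0.
  by apply/eqP; rewrite eq_le h0 integral_ge0.
move=> /(_ erefl) hz; near=> x.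
have fz : f k x @[k --> \oo] --> (z x - (v x)%:E) * (z x - (v x)%:E).
  have zv : (u k x)%:E - (v x)%:E @[k --> \oo] --> z x - (v x)%:E.
    apply: cvgeB; [by rewrite fin_num_adde_defl|by near: x|exact: cvg_cst].
  rewrite /f; under eq_fun do rewrite expr2 EFinM EFinB.
  by apply: cvgeM => //; case: (z x) => [r| |].
have : h x = 0 by (have : setT x by []); near: x.
(* An infinite [z x] would make the factor [z x - v x] infinite, so a zero product forces [z x] to
   be real and equal to [v x]. *)
rewrite /h (cvg_limn_einf_sup fz).1 => /eqP; rewrite mule_eq0 orbb.
by case: (z x) => [r| |]//; rewrite -EFinB eqe subr_eq0 => /eqP ->.
Unshelve. all: by end_near. Qed.

End square_integrable.

(** * Sums of nonnegative families *)

Section esum_extra.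
Context (R : realType).
Local Open Scope ereal_scope.

Lemma esumZl (I : choiceType) (D : set I) (a : I -> \bar R) (c : R) :
  (0 <= c)%R -> (forall i, 0 <= a i) ->
  \esum_(i in D) (c%:E * a i) = c%:E * \esum_(i in D) a i.
Proof.
move=> c0 a0; rewrite /esum -ereal_supZl//; last first.
  apply/set0P; exists 0; exists set0; first exact: fsets_set0.
  by rewrite fsbig_set0.
congr ereal_sup; rewrite image_comp.
by apply: eq_imagel => F [finF _] /=; rewrite ge0_mule_fsumr.
Qed.

Lemma prode_fin_num (I : finType) (F : I -> \bar R) :
  (forall i, F i \is a fin_num) -> \prod_i F i \is a fin_num.
Proof.
move=> Ffin; elim/big_ind : _ => // x y; exact: fin_numM.
Qed.

Lemma le_esum_sub (I : choiceType) (D E : set I) (a : I -> \bar R) :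
  D `<=` E -> (forall i, 0 <= a i) -> \esum_(i in D) a i <= \esum_(i in E) a i.
Proof.
move=> DE a0; rewrite (esum_mkcond D) (esum_mkcond E); apply: le_esum => i _.
case: ifPn => [/set_mem/DE iE|_]; first by rewrite mem_set.
by case: ifPn.
Qed.

Lemma esum_box (I : choiceType) (n : nat) (A : 'I_n -> set I)
    (g : 'I_n -> I -> R) :
  (forall j i, 0 <= g j i)%R ->
  (forall j, \esum_(i in A j) (g j i)%:E < +oo) ->
  \esum_(t in box A) (\prod_(j < n) g j (tnth t j))%:E =
  \prod_(j < n) \esum_(i in A j) (g j i)%:E.
Proof.
elim: n A g => [|n IH] A g g0 gfin.
  have -> : box A = [set [tuple]].
    by apply/seteqP; split => [t _|t _]; [rewrite /= [t]tuple0|case].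
  by rewrite esum_set1 !big_ord0// lee_fin.
pose B := box (A \o lift ord0).
have bij : set_bij (A ord0 `*`` fun=> B) (box A)
    (fun p : I * n.-tuple I => [tuple of p.1 :: p.2]).
  split.
  - move=> [i t] [/= Ai Bt] j.
    case: (unliftP ord0 j) => [k ->|->]; last exact: Ai.
    by rewrite tnthS; exact: Bt.
  - by move=> [i t] [i' t'] _ _ /= /(congr1 val)/= [-> /val_inj ->].
  - move=> t At; exists (thead t, [tuple of behead t]); last first.
      by rewrite /= -tuple_eta.
    split; first exact: (At ord0).
    by move=> j /=; rewrite tnth_behead; have := At (lift ord0 j);
      rewrite (_ : inord j.+1 = lift ord0 j)//; apply: val_inj;
      rewrite /= inordK// ltnS.
rewrite (reindex_esum _ _ _ _ bij).
rewrite big_ord_recl /= -IH//.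
pose h (i : I) (t : n.-tuple I) :=
  (g ord0 i)%:E * (\prod_(j < n) g (lift ord0 j) (tnth t j))%:E.
have h0 t : 0 <= (\prod_(j < n) g (lift ord0 j) (tnth t j))%:E.
  by rewrite lee_fin prodr_ge0.
transitivity (\esum_(p in A ord0 `*`` fun=> B) h p.1 p.2).
  apply: eq_esum => -[i t] _ /=; rewrite /h -EFinM big_ord_recl.
  congr (_ * _)%:E; apply: eq_bigr => j _; congr (g _ _).
  by rewrite tnthS.
rewrite -(esum_esum (a := h)); last first.
  by move=> i t _ _; rewrite /h mule_ge0// lee_fin.
pose E := \esum_(t in B) (\prod_(j < n) g (lift ord0 j) (tnth t j))%:E.
have Efin : E \is a fin_num.
  rewrite /E /B (IH _ (fun j => g (lift ord0 j)))//; last by move=> j; exact: gfin.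
  apply: prode_fin_num => j.
  rewrite ge0_fin_numE; first exact: gfin.
  by apply: esum_ge0 => i _; rewrite lee_fin.
transitivity (\esum_(i in A ord0) (fine E)%:E * (g ord0 i)%:E).
  apply: eq_esum => i _; rewrite /h esumZl// fineK// muleC//.
rewrite esumZl; [|by apply: fine_ge0; exact: esum_ge0|by move=> i; rewrite lee_fin].
by rewrite fineK// muleC.
Qed.

End esum_extra.

(** * Jump sums and the jump measure along one increasing path *)

Section jump_path.
Context (R : realType) (x : R -> R) (tau : nat -> \bar R) (T : R).
Hypotheses (cx : cadlag x)
  (ndx : forall s u : R, 0 <= s -> s <= u -> x s <= x u).
Hypotheses (tau_jump : forall k t, tau k = t%:E -> jump x t != 0)
  (jump_tau : forall t : R, 0 <= t -> jump x t != 0 -> exists k, tau k = t%:E).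
Local Open Scope ereal_scope.

Let x0 t : (0 <= jump x t)%R. Proof. exact: jump_ge0. Qed.

Let xk0 k t : 0 <= (jump x t ^+ k)%:E.
Proof. by rewrite lee_fin exprn_ge0. Qed.

(** Every entry is a time where [x] jumps, and by convention [jump] vanishes at nonpositive
    times. *)
Lemma jump_tuples_box n :
  jump_tuples T tau `<=` box (fun _ : 'I_n => `]0%R, T]%classic).
Proof.
move=> t [_ tJ] j; have [tT [k tk]] := tJ j.
rewrite /= in_itv /= tT andbT ltNge; apply/negP => t0.
by have := tau_jump tk; rewrite /jump ltNge t0 eqxx.
Qed.

Lemma jump_measure_null n (r : 'I_n -> nat) (A : set (n.-tuple R)) :
  (forall t, jump_tuples T tau t -> ~ A t) -> jump_measure x tau T r A = 0.
Proof.
move=> JA; apply: esum1 => t /JA At.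
by rewrite diracE memNset// mule0.
Qed.

Hypothesis jump_fin : \esum_(s in `]0%R, T]) (jump x s)%:E < +oo.

(** A single jump is at most the total [M] of the jumps, so its power of order [k] is at most
    [M^(k-1)] times the jump itself. *)
Lemma esum_jump_exp_lty k : (0 < k)%N ->
  \esum_(s in `]0%R, T]) (jump x s ^+ k)%:E < +oo.
Proof.
case: k => // k _.
pose M := fine (\esum_(s in `]0%R, T]) (jump x s)%:E).
have M0 : (0 <= M)%R by apply: fine_ge0; apply: esum_ge0 => s _; rewrite lee_fin.
have jM s : s \in `]0%R, T] -> (jump x s <= M)%R.
  move=> sT; rewrite -lee_fin /M fineK; last first.
    by rewrite ge0_fin_numE//; apply: esum_ge0 => ? _; rewrite lee_fin.
  rewrite -(esum_set1 (t := s) (a := fun s => (jump x s)%:E)) ?lee_fin//.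
  by apply: le_esum_sub => [_ ->//|i]; rewrite lee_fin.
apply: (@le_lt_trans _ _ (\esum_(s in `]0%R, T]) ((M ^+ k)%:E * (jump x s)%:E))).
  apply: le_esum => s sT; rewrite -EFinM lee_fin exprSr ler_wpM2r//.
  by rewrite lerXn2r ?nnegrE//; exact: jM.
rewrite esumZl ?exprn_ge0//.
by rewrite lte_mul_pinfty ?lee_fin ?exprn_ge0.
Qed.

(** The right-hand side is the increment of [power_jump] that [jump_L2_itv] assigns to []a, b]].
    Finiteness turns additivity over adjacent intervals into a difference of reals. *)
Lemma esum_jump_exp_itv k (a b : R) : (0 < k)%N ->
  (0 <= a)%R -> (a <= b)%R -> (b <= T)%R ->
  \esum_(s in `]a, b]) (jump x s ^+ k)%:E =
  (fine (\esum_(s in `]0%R, b]) (jump x s ^+ k)%:E) -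
   fine (\esum_(s in `]0%R, a]) (jump x s ^+ k)%:E))%:E.
Proof.
move=> k0 a0 ab bT.
have fin (c : R) : (c <= T)%R ->
    \esum_(s in `]0%R, c]) (jump x s ^+ k)%:E \is a fin_num.
  move=> cT; rewrite ge0_fin_numE; last by apply: esum_ge0.
  apply: le_lt_trans (esum_jump_exp_lty k0); apply: le_esum_sub => //.
  by apply: subset_itvl; rewrite bnd_simp.
have aT := le_trans ab bT.
have -> : \esum_(s in `]0%R, b]) (jump x s ^+ k)%:E =
    \esum_(s in `]0%R, a]) (jump x s ^+ k)%:E +
    \esum_(s in `]a, b]) (jump x s ^+ k)%:E.
  rewrite (esumID `]0%R, a]%classic) => [|i _]; last exact: xk0.
  congr (_ + _); congr (esum _ _); apply/seteqP; split => s /=.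
  - by case.
  - rewrite !in_itv/= => /andP[s0 sa]; rewrite s0 sa; split => //.
    exact: le_trans ab.
  - rewrite !in_itv/= => -[/andP[s0 sb]] /negP; rewrite s0/= -ltNge => ->.
    by rewrite sb.
  - rewrite !in_itv/= => /andP[sa sb]; rewrite sb (le_lt_trans a0 sa); split => //.
    by apply/negP; rewrite -ltNge.
have fab : \esum_(s in `]a, b]) (jump x s ^+ k)%:E \is a fin_num.
  rewrite ge0_fin_numE; last by apply: esum_ge0.
  apply: le_lt_trans (esum_jump_exp_lty k0); apply: le_esum_sub => //.
  by apply: subset_itv; rewrite bnd_simp.
by rewrite fineD ?fin// addrAC subrr add0r fineK.
Qed.

Variables (n : nat) (r : 'I_n -> nat).
Hypothesis r0 : forall j, (0 < r j)%N.

(** Enlarging the index set from jump tuples to the whole box []0, T]^n] gives an upper bound that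
    factors into finite power sums. *)
Lemma jump_measure_lty : jump_measure x tau T r setT < +oo.
Proof.
rewrite /jump_measure.
apply: (@le_lt_trans _ _ (\esum_(t in box (fun _ : 'I_n => `]0%R, T]%classic))
    (\prod_(j < n) jump x (tnth t j) ^+ r j)%:E)).
  rewrite [leLHS](eq_esum (b := fun t =>
    (\prod_(j < n) jump x (tnth t j) ^+ r j)%:E)).
    apply: le_esum_sub; first exact: jump_tuples_box.
    by move=> t; rewrite lee_fin prodr_ge0// => j _; rewrite exprn_ge0.
  by move=> t _; rewrite diracT mule1.
rewrite (esum_box (g := fun j s => jump x s ^+ r j)%R).
- rewrite ltey_eq prode_fin_num// => j.
  rewrite ge0_fin_numE; last by apply: esum_ge0.
  exact: esum_jump_exp_lty.
- by move=> j s; rewrite exprn_ge0.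
- by move=> j; exact: esum_jump_exp_lty.
Qed.

(** Disjoint sides make the entries of a tuple distinct. A tuple of the box that is not a jump tuple
    thus has an entry outside the range of [tau], where the jump is zero; as the exponents are
    positive, its term vanishes. The sum therefore runs over the whole box and factors. *)
Lemma jump_measure_box (A : 'I_n -> set R) :
  (forall j, A j `<=` `]0%R, T]) ->
  (forall i j, i != j -> A i `&` A j = set0) ->
  jump_measure x tau T r (box A) =
  \prod_(j < n) \esum_(s in A j) (jump x s ^+ r j)%:E.
Proof.
move=> AT Adisj.
rewrite -(esum_box (g := fun j s => jump x s ^+ r j)%R); last 2 first.
- by move=> j s; rewrite exprn_ge0.
- move=> j; apply: le_lt_trans (esum_jump_exp_lty (r0 j)).
  exact: le_esum_sub.
rewrite /jump_measure (esum_mkcond (jump_tuples T tau)) (esum_mkcond (box A)).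
apply: eq_esum => t _; rewrite diracE.
have [tA|tA] := boolP (t \in box A); last by rewrite mule0; case: ifP.
rewrite mule1; case: ifPn => // /negP tJ; apply/esym; congr EFin.
have {}tA := set_mem tA.
have ut : uniq t.
  apply/tuple_uniqP => i j tij; apply/eqP/negPn/negP => ij.
  have : (A i `&` A j) (tnth t i) by split; [|rewrite tij]; exact: tA.
  by rewrite (Adisj _ _ ij).
have [j tj] : exists j, ~ exists k, tau k = (tnth t j)%:E.
  apply/existsNP => h; apply: tJ; apply/mem_set; split => // j; split; last exact: h.
  by have := AT j _ (tA j); rewrite /= in_itv/= => /andP[].
rewrite (bigD1 j)//=.
have -> : jump x (tnth t j) = 0%R.
  apply/eqP/negPn/negP => h; apply: tj; apply: jump_tau => //.
  by have := AT j _ (tA j); rewrite /= in_itv/= => /andP[/ltW].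
by rewrite expr0n eqn0Ngt r0 mul0r.
Qed.

End jump_path.

(** * Null sets of product measures *)

Section tuple_measure_ae.
Context (R : realType) (mu : {finite_measure set R -> \bar R}).
Local Open Scope ereal_scope.

(** For each [j] the exceptional set is a box with one side [Z] and all others the whole line, so
    one factor of its measure is zero. *)
Lemma ae_tuple_coord n (Z : set R) : measurable Z -> mu Z = 0 ->
  {ae tuple_measure mu n, forall t, forall j, ~ Z (tnth t j)}.
Proof.
move=> mZ Z0; apply: filter_forall => j.
pose B i := if i == j then Z else setT.
have mB i : measurable (B i) by rewrite /B; case: ifP.
have [mbox Ebox] := tuple_measure_box mu mB.
exists (box B); split => //.
  by rewrite Ebox (bigD1 j)//= /B eqxx Z0 mul0e.
move=> t /= /contrapT Zt i; rewrite /B; case: ifPn => // /eqP ->.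
exact: Zt.
Qed.

(** A repetition is a zero of the difference of two coordinates, and there are finitely many pairs
    of coordinates. *)
Lemma measurable_not_uniq n :
  measurable [set t : n.-tuple R | ~ uniq t].
Proof.
rewrite [X in measurable X](_ : _ =
  \bigcup_(p in [set p : 'I_n * 'I_n | p.1 != p.2])
    ((fun t : n.-tuple R => (tnth t p.1 - tnth t p.2)%R) @^-1` [set 0%R])).
  apply: fin_bigcup_measurable => //= -[i j] _ /=.
  rewrite -[X in measurable X]setTI.
  apply: measurable_funB => //; exact: measurable_tnth.
apply/seteqP; split => t /=.
  move=> ut; apply: contrapT => h; apply: ut; apply/tuple_uniqP => i j tij.
  apply/eqP/negPn/negP => ij; apply: h; exists (i, j) => //=.
  by rewrite tij subrr.
move=> [[i j] /= ij /eqP]; rewrite subr_eq0 => /eqP tij /tuple_uniqP ut.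
by move: ij; rewrite (ut _ _ tij) eqxx.
Qed.

(** Fubini on the first coordinate: for fixed head [x], a tuple with a repetition has a tail that
    contains [x] or itself repeats. The first case is null because [mu] has no atoms, the second by
    induction. *)
Lemma ae_tuple_uniq n : (forall x : R, mu [set x] = 0) ->
  {ae tuple_measure mu n, forall t : n.-tuple R, uniq t}.
Proof.
move=> mu1; elim: n => [|n IH].
  by apply: nearW => t; rewrite (tuple0 t).
exists [set t : n.+1.-tuple R | ~ uniq t]; split => //.
  exact: measurable_not_uniq.
rewrite /= /cons_measure /pushforward /product_measure1 /=.
apply: integral0_eq => x _.
apply: measure_negligible.
  apply: measurable_xsection; rewrite -[X in measurable X]setTI.
  apply: measurable_consp => //; exact: measurable_not_uniq.
apply: (negligibleS (A := ~` [set t : n.-tuple R |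
    (forall j, ~ [set x] (tnth t j)) /\ uniq t])).
  move=> t; rewrite /xsection /= inE /= => /negP.
  rewrite negb_and negbK => tx [xt ut]; case/orP : tx; last by rewrite ut.
  by move=> /tnthP[j xj]; exact: (xt j).
exact: filterI (ae_tuple_coord n (measurable_set1 x) (mu1 x)) IH.
Qed.

End tuple_measure_ae.

(** * A generating pi-system of boxes of rays *)

Section upper_rays.
Context (R : realType).

Definition upper_ray (B : set R) := B = setT \/ exists b, B = `]b, +oo[%classic.

Lemma measurable_upper_ray B : upper_ray B -> measurable B.
Proof. by move=> [->|[b ->]]//; exact: measurable_itv. Qed.

Lemma upper_rayI B C : upper_ray B -> upper_ray C -> upper_ray (B `&` C).
Proof.
move=> [->|[b ->]] [->|[c ->]].
- by left; rewrite setIT.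
- by right; exists c; rewrite setTI.
- by right; exists b; rewrite setIT.
- right; exists (Num.max b c); apply/seteqP; split => x /=;
    rewrite !in_itv/= !andbT gt_max.
    by move=> [-> ->].
  by move/andP.
Qed.

Lemma upper_ray_itv B (c d : R) : c <= d -> upper_ray B ->
  exists a, [/\ c <= a, a <= d & B `&` `]c, d] = `]a, d]%classic].
Proof.
move=> cd [->|[b ->]]; first by exists c; rewrite setTI; split.
(* Truncation at [d] turns an empty intersection into the degenerate interval []d, d]]. *)
exists (Num.min d (Num.max b c)); split.
- by rewrite le_min cd le_max lexx orbT.
- by rewrite ge_min lexx.
- apply/seteqP; split => x /=; rewrite !in_itv/= ?andbT gt_min gt_max.
    by move=> [-> /andP[-> ->]]; rewrite orbT.
  move=> /andP[+ xd]; rewrite xd andbT ltNge xd/=.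
  by move/andP.
Qed.

Definition ray_boxes n : set (set (n.-tuple R)) :=
  [set C | exists2 B : 'I_n -> set R, (forall j, upper_ray (B j)) & C = box B].
Arguments ray_boxes : clear implicits.

Lemma ray_boxesI n : setI_closed (ray_boxes n).
Proof.
move=> _ _ [B rB ->] [C rC ->]; exists (fun j => B j `&` C j).
  by move=> j; exact: upper_rayI.
apply/seteqP; split => t /=; first by move=> [Bt Ct] j; split.
by move=> BC; split=> j; have [] := BC j.
Qed.

(** One inclusion says that the identity is measurable from the generated sigma-algebra. This is
    checked coordinate by coordinate, on the open rays that generate the Borel sets of the line. *)
Lemma measurable_ray_boxes n :
  @measurable _ (n.-tuple R) = <<s ray_boxes n >>.
Proof.
apply/seteqP; split => A mA.
  pose G := g_sigma_algebraType (ray_boxes n).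
  suff : measurable_fun [set: G] (id : G -> n.-tuple R).
    by move=> /(_ measurableT _ mA); rewrite setTI.
  apply/measurable_fun_tnthP => j.
  apply: (measurability _ (RGenOInfty.measurableE R)).
  move=> _ [_ [b ->] <-]; apply: sub_sigma_algebra; rewrite setTI.
  exists (fun i => if i == j then `]b, +oo[%classic else setT).
    by move=> i; case: ifP => _; [right; exists b|left].
  apply/seteqP; split => t /=.
    by move=> tb i; case: ifPn => // /eqP ->.
  by move=> /(_ j); rewrite eqxx.
move: A mA; apply: smallest_sub; first exact: sigma_algebra_measurable.
move=> _ [B rB ->].
have mB j : measurable (B j) by exact: measurable_upper_ray.
rewrite (_ : box B = \bigcap_(j in [set: 'I_n])
      ((fun x : n.-tuple R => tnth x j) @^-1` B j)); last first.
  by apply/seteqP; split => x /=; [move=> Bx j _; exact: Bx|move=> Bx j; exact: Bx].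
apply: fin_bigcap_measurable => // j _.
by rewrite -[X in measurable X]setTI; exact: measurable_tnth.
Qed.

End upper_rays.
Arguments ray_boxes : clear implicits.

(** * The uniform grid on []0, T]] *)

Section cells.
Context (R : realType) (T : R) (T0 : 0 < T).

(** The mesh is [T / N.+1], so that every [N] gives a grid. The cells are half-open, like the
    intervals on which [phi] is prescribed. *)
Definition cell (N i : nat) : set R :=
  `]i%:R * (T / N.+1%:R), i.+1%:R * (T / N.+1%:R)]%classic.

Let h0 N : 0 < T / N.+1%:R. Proof. by rewrite divr_gt0. Qed.

Lemma cell_inj N i j x : cell N i x -> cell N j x -> i = j.
Proof.
rewrite /cell /= !in_itv/= => /andP[xi ix] /andP[xj jx].
have := lt_le_trans xi jx; have := lt_le_trans xj ix.
rewrite !ltr_pM2r ?h0// !ltr_nat !ltnS => ji ij.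
by apply/eqP; rewrite eqn_leq ij ji.
Qed.

Lemma cell_cover N x : 0 < x -> x <= T -> exists i : 'I_N.+1, cell N i x.
Proof.
move=> x0 xT.
have ex : exists k, x <= k%:R * (T / N.+1%:R).
  by exists N.+1; rewrite mulrC divfK// pnatr_eq0.
(* The first grid point not below [x] has positive index because [x] is positive; its predecessor
   indexes the cell. *)
case: (ex_minnP ex) => -[|k]; first by rewrite mul0r leNgt x0.
move=> xk kmin; have kN : (k < N.+1)%N.
  by apply: kmin; rewrite mulrC divfK// pnatr_eq0.
exists (Ordinal kN); rewrite /cell /= in_itv/= xk andbT ltNge.
by apply/negP => /kmin; rewrite ltnn.
Qed.

Lemma cell_diam N i x y : cell N i x -> cell N i y -> `|x - y| <= T / N.+1%:R.
Proof.
rewrite /cell /= !in_itv/= => /andP[ix xi] /andP[iy yi].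
have e : i.+1%:R * (T / N.+1%:R) = i%:R * (T / N.+1%:R) + T / N.+1%:R.
  by rewrite -natr1 mulrDl mul1r.
rewrite ler_norml lerNl opprB !lerBlDl.
apply/andP; split.
  by rewrite (le_trans yi)// e lerD2r ltW.
by rewrite (le_trans xi)// e lerD2r ltW.
Qed.

Lemma cell_bounds N (i : 'I_N.+1) :
  [/\ 0 <= i%:R * (T / N.+1%:R) :> R,
      i%:R * (T / N.+1%:R) <= i.+1%:R * (T / N.+1%:R) &
      i.+1%:R * (T / N.+1%:R) <= T].
Proof.
split.
- by rewrite mulr_ge0// ltW.
- by rewrite ler_wpM2r ?ler_nat// ltW.
- rewrite -[leRHS](divfK (x := N.+1%:R)) ?pnatr_eq0// mulrC ler_wpM2l ?ler_nat//.
  exact: ltW.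
Qed.

End cells.

(** * The class of functions whose multiple integral is a pathwise integral *)

Section pathwise_integral.
Context d (Omega : measurableType d) (R : realType) (P : probability Omega R).
Context (T : R) (n : nat) (phi : nat -> set R -> Omega -> R) (r : 'I_n -> nat)
  (I : (n.-tuple R -> R) -> Omega -> R).
Hypothesis hI : multiple_ito_integral P T phi r I.
Variable m : Omega -> {measure set (n.-tuple R) -> \bar R}.
Local Open Scope ereal_scope.

(** Integrability belongs to the class because additivity of the integral of signed functions relies
    on it. *)
Definition pathwise (f : n.-tuple R -> R) : Prop :=
  f \in Lfun (leb T n) 2%:E /\
  {ae P, forall w, (m w).-integrable setT (EFin \o f) /\
    (I f w)%:E = \int[m w]_x (f x)%:E}.

Let mLfun (f : n.-tuple R -> R) : f \in Lfun (leb T n) 2%:E ->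
  measurable_fun setT f.
Proof. by case/Lfun2P. Qed.

Lemma pathwise0 : pathwise (fun=> 0%R).
Proof.
have L0 : (fun=> 0%R) \in Lfun (leb T n) 2%:E by exact: Lfun_cst.
split => //.
(* With coefficient -1, linearity at zero reads [I 0 = - I 0 + I 0], so [I 0] vanishes almost
   surely. *)
have := ito_linear hI (-1) L0 L0.
have -> : (fun=> -1 * 0 + 0)%R = (fun=> 0%R) :> (n.-tuple R -> R).
  by apply/funext => x; rewrite mulr0 addr0.
apply: filterS => w /(_ Logic.I) ->.
rewrite mulN1r addNr integral0_eq//; split => //.
exact: integrable0.
Qed.

Lemma pathwise_lin (c : R) f g : pathwise f -> pathwise g ->
  pathwise (fun x => c * f x + g x)%R.
Proof.
move=> [Lf hf] [Lg hg]; split.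
  exact: Lfun2_lin.
have := ito_linear hI c Lf Lg.
apply: filterS3 hf hg => w [if_ ef] [ig eg] /(_ Logic.I) ->.
have icf : (m w).-integrable setT (fun x => c%:E * (f x)%:E).
  exact: integrableZl.
split.
  rewrite (_ : EFin \o _ = (fun x => c%:E * (f x)%:E) \+ (EFin \o g))//.
  exact: integrableD.
under eq_integral do rewrite EFinD EFinM.
rewrite integralD// integralZl// EFinD EFinM ef eg//.
Qed.

Lemma pathwise_sum (J : Type) (s : seq J) (Q : pred J)
    (F : J -> n.-tuple R -> R) :
  (forall i, Q i -> pathwise (F i)) ->
  pathwise (fun x => \sum_(i <- s | Q i) F i x)%R.
Proof.
move=> QF; elim: s => [|i s IH].
  under eq_fun do rewrite big_nil; exact: pathwise0.
have [Qi|/negPf nQi] := boolP (Q i); last first.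
  by under eq_fun do rewrite big_cons nQi.
under eq_fun do rewrite big_cons Qi -[F i _]mul1r.
by apply: pathwise_lin => //; exact: QF.
Qed.

(** The variables [I (u k)] tend to [I f] in L^2(P) by continuity, and almost surely to the pathwise
    integral of [f]; the two limits agree. Integrability of [f] under [m w] is established
    separately at each use. *)
Lemma pathwise_cvg (u : nat -> n.-tuple R -> R) (f : n.-tuple R -> R) :
  (forall k, pathwise (u k)) -> f \in Lfun (leb T n) 2%:E ->
  (forall e : R, (0 < e)%R -> \forall k \near \oo,
    'N[leb T n]_2%:E[EFin \o (u k \- f)%R] < e%:E) ->
  {ae P, forall w, \int[m w]_x (u k x)%:E @[k --> \oo] -->
    \int[m w]_x (f x)%:E} ->
  {ae P, forall w, (I f w)%:E = \int[m w]_x (f x)%:E}.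
Proof.
move=> Ku Lf uf mf.
apply: (@Lnorm2_cvg_unique _ _ _ P (fun k => I (u k)) (I f)
  (fun w => \int[m w]_x (f x)%:E)).
- by move=> k; have [/(ito_L2 hI)/Lfun2P[]] := Ku k.
- by have /Lfun2P[] := ito_L2 hI Lf.
- move=> e e0; have [del del0 hdel] := ito_continuous hI Lf e0.
  have := uf _ del0; apply: filterS => k; apply: hdel.
  by have [] := Ku k.
- have : {ae P, forall w k, (I (u k) w)%:E = \int[m w]_x (u k x)%:E}.
    apply/ae_foralln => k; have [_] := Ku k.
    by apply: filterS => w [].
  apply: filterS2 mf => w mw Iw.
  by under eq_fun do rewrite Iw.
Qed.

Hypothesis m_lty : {ae P, forall w, m w setT < +oo}.

Lemma bounded1_Lfun2 (f : n.-tuple R -> R) : measurable_fun setT f ->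
  (forall x, `|f x| <= 1)%R -> f \in Lfun (leb T n) 2%:E.
Proof.
move=> mf f1; apply: (@le_Lfun2 _ _ _ _ _ (cst 1%R)) => //.
  by move=> x; rewrite normr1.
exact: Lfun_cst.
Qed.

(** Dominated convergence is applied twice with the constant 1 as bound: under the finite measure
    [leb T n] for convergence in L^2, and under the almost surely finite [m w] for the pathwise
    integrals. *)
Lemma pathwise_bounded_cvg (u : nat -> n.-tuple R -> R) (f : n.-tuple R -> R) :
  (forall k, pathwise (u k)) -> measurable_fun setT f ->
  (forall k x, `|u k x| <= 1)%R -> (forall x, `|f x| <= 1)%R ->
  {ae leb T n, forall x, u k x @[k --> \oo] --> f x} ->
  (forall w, {ae m w, forall x, u k x @[k --> \oo] --> f x}) ->
  pathwise f.
Proof.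
move=> Ku mf u1 f1 uf muf.
have mu k : measurable_fun setT (u k) by apply: mLfun; have [] := Ku k.
have Lf : f \in Lfun (leb T n) 2%:E by exact: bounded1_Lfun2.
split => //.
have h w : m w setT < +oo -> (m w).-integrable setT (EFin \o f) /\
    \int[m w]_x (u k x)%:E @[k --> \oo] --> \int[m w]_x (f x)%:E.
  move=> mw.
  have i1 : (m w).-integrable setT (cst 1%:E).
    apply/integrableP; split; first exact: measurable_cst.
    by under eq_integral do rewrite /= normr1; rewrite integral_cst// mul1e.
  have [|||||] := @dominated_convergence _ _ _ (m w) setT measurableT
    (fun k x => (u k x)%:E) (EFin \o f) (cst 1%:E).
  - by move=> k; exact/measurable_EFinP.
  - exact/measurable_EFinP.
  - apply: filterS (muf w) => x ux _; apply: cvg_EFin => //; exact: nearW.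
  - exact: i1.
  - by apply: nearW => x k _ /=; rewrite lee_fin.
  - by [].
have hA : {ae P, forall w, (I f w)%:E = \int[m w]_x (f x)%:E}.
  apply: (pathwise_cvg Ku Lf); last by apply: filterS m_lty => w /h[].
  apply: (@dominated_Lnorm2 _ _ _ _ _ _ (cst 1%R)) => //.
  exact: Lfun_cst.
by apply: filterS2 hA m_lty => w -> /h[].
Qed.

(** A common set of full measure for [leb T n] and all [m w]. The value 0 is left out because the
    cells are open on the left. *)
Definition off_diagonal (t : n.-tuple R) :=
  uniq t /\ forall j, (0 < tnth t j)%R /\ (tnth t j <= T)%R.

Lemma ae_leb_off_diagonal : (0 < T)%R -> {ae leb T n, forall t, off_diagonal t}.
Proof.
move=> T0; apply: filterI.
  apply: ae_tuple_uniq => x; apply/eqP; rewrite -measure_le0.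
  rewrite -(lebesgue_measure_set1 x); apply: le_measure; rewrite ?inE//.
  by apply: measurableI => //; exact: measurable_itv.
have mZ : measurable (~` `]0%R, T]%classic : set R).
  by apply: measurableC; exact: measurable_itv.
(* Since [leb1 T] lives on [[0, T]], only the point 0 remains. *)
have Z0 : leb1 T (~` `]0%R, T]) = 0.
  apply/eqP; rewrite -measure_le0 -(lebesgue_measure_set1 (0%R : R)).
  apply: le_measure; rewrite ?inE//.
    by apply: measurableI => //; exact: measurable_itv.
  move=> x []; rewrite /= !in_itv/= => /negP + /andP[x0 xT].
  rewrite xT andbT -leNgt => x0'.
  by apply/eqP; rewrite eq_le x0 x0'.
apply: filterS (ae_tuple_coord n mZ Z0) => t tZ j.
by have /contrapT := tZ j; rewrite /= in_itv/= => /andP[].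
Qed.

Hypothesis hT : (0 < T)%R.
Hypothesis m_off_diagonal : forall w, {ae m w, forall t, off_diagonal t}.
(** The jumps enter this section only through the finiteness of [m], its concentration off the
    diagonals and this base case. *)
Hypothesis pathwise_itv_box : forall a b : 'I_n -> R,
  (forall j, [/\ 0 <= a j, a j <= b j & b j <= T])%R ->
  (forall i j, i != j ->
    `]a i, b i]%classic `&` `]a j, b j]%classic = set0) ->
  pathwise \1_(box (fun j => `]a j, b j]%classic)).

Definition off_diagonal_cells (N : nat) : set (n.-tuple R) :=
  [set x | exists2 i : n.-tuple 'I_N.+1, uniq i &
    forall j, cell T N (tnth i j) (tnth x j)].

(** Finitely many distinct coordinates have a positive smallest gap; once the mesh is below it, no
    two of them share a cell. *)
Lemma near_off_diagonal_cells x : off_diagonal x ->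
  \forall N \near \oo, off_diagonal_cells N x.
Proof.
move=> [ux xT].
have : \forall N \near \oo, forall p : 'I_n * 'I_n, p.1 != p.2 ->
    (T / N.+1%:R < `|tnth x p.1 - tnth x p.2|)%R.
  apply: filter_forall => -[i j] /=.
  have [->|ij] := eqVneq i j; first by apply: nearW.
  have xij : (0 < `|tnth x i - tnth x j| / T)%R.
    rewrite divr_gt0// normr_gt0 subr_eq0; apply: contra ij => /eqP xij.
    by apply/eqP; move/tuple_uniqP : ux; exact.
  have := near_infty_natSinv_lt (PosNum xij); apply: filterS => N /= h _.
  by rewrite mulrC -ltr_pdivlMr.
apply: filterS => N hN.
have /choice[c hc] : forall j, exists i : 'I_N.+1, cell T N i (tnth x j).
  by move=> j; have [x0 xT'] := xT j; exact: cell_cover.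
exists [tuple c j | j < n]; last by move=> j; rewrite tnth_mktuple.
apply/tuple_uniqP => i j; rewrite !tnth_mktuple => cij.
apply/eqP/negPn/negP => ij; have := hN (i, j) ij; rewrite /= ltNge.
by rewrite (@cell_diam _ _ _ (c i))//; rewrite cij.
Qed.

Lemma pathwise_ray_box (B : 'I_n -> set R) : (forall j, upper_ray (B j)) ->
  pathwise \1_(box B).
Proof.
move=> rB.
have mB j : measurable (B j) by exact: measurable_upper_ray.
have [mbB _] := tuple_measure_box (leb1 T) mB.
(* Restricting to tuples of distinct cells makes every summand the indicator of a box with pairwise
   disjoint sides. Cells being disjoint, at most one summand is nonzero at a given point. *)
pose u N : n.-tuple R -> R := fun x =>
  (\sum_(i : n.-tuple 'I_N.+1 | uniq i)
    \1_(box (fun j => B j `&` cell T N (tnth i j))) x)%R.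
have uE N : u N = \1_(box B `&` off_diagonal_cells N).
  apply/funext => x; rewrite /u.
  have [[Bx [i ui ix]]|xNB] := pselect ((box B `&` off_diagonal_cells N) x).
    rewrite [RHS]indicE mem_set; last by split => //; exists i.
    rewrite (bigD1 i)//= indicE mem_set; last first.
      by move=> j; split; [exact: Bx|exact: ix].
    rewrite big1 ?addr0// => k /andP[uk ki]; rewrite indicE memNset// => kx.
    move/eqP : ki; apply; apply: eq_from_tnth => j; apply: val_inj.
    by have [_ kj] := kx j; exact: (cell_inj hT kj (ix j)).
  rewrite [RHS]indicE memNset// big1// => i ui; rewrite indicE memNset// => ix.
  by apply: xNB; split; [move=> j; have [] := ix j|exists i => // j; have [] := ix j].
have cvgu x : off_diagonal x -> u N x @[N --> \oo] --> (\1_(box B) x : R).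
  move=> /near_off_diagonal_cells xN; apply: cvg_near_cst.
  apply: filterS xN => N xN; rewrite uE !indicE in_setI.
  by rewrite (mem_set xN) andbT.
apply: (@pathwise_bounded_cvg u).
- move=> N; apply: pathwise_sum => i ui.
  (* A ray meets a cell in an interval with the same right end, possibly empty, so the base case
     applies. *)
  have /choice[a ha] : forall j, exists a,
      [/\ (tnth i j)%:R * (T / N.+1%:R) <= a,
          a <= (tnth i j).+1%:R * (T / N.+1%:R) &
       B j `&` cell T N (tnth i j) =
         `]a, (tnth i j).+1%:R * (T / N.+1%:R)]%classic]%R.
    move=> j; apply: upper_ray_itv => //.
    by have [] := cell_bounds hT (tnth i j).
  have -> : (fun j => B j `&` cell T N (tnth i j)) =
      (fun j => `]a j, ((tnth i j).+1%:R * (T / N.+1%:R))%R]%classic).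
    by apply/funext => j; have [] := ha j.
  apply: pathwise_itv_box => [j|j k jk].
    have [? ? ?] := ha j; have [? ? ?] := cell_bounds hT (tnth i j).
    by split => //; apply: le_trans; eassumption.
  have [_ _ <-] := ha j; have [_ _ <-] := ha k.
  apply/seteqP; split => // x [[_ jx] [_ kx]].
  have /val_inj/(tuple_uniqP _ ui)/eqP := cell_inj hT jx kx.
  by rewrite (negPf jk).
- exact: measurable_indic.
- by move=> N x; rewrite uE indicE; case: (_ \in _); rewrite ?normr0 ?normr1.
- by move=> x; rewrite indicE; case: (_ \in _); rewrite ?normr0 ?normr1.
- by apply: filterS (ae_leb_off_diagonal hT) => x; exact: cvgu.
- by move=> w; apply: filterS (m_off_diagonal w) => x; exact: cvgu.
Qed.

Lemma pathwise_indic (A : set (n.-tuple R)) : measurable A -> pathwise \1_A.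
Proof.
have norm_indic (B : set (n.-tuple R)) x : (`|\1_B x| <= 1 :> R)%R.
  by rewrite indicE; case: (_ \in _); rewrite ?normr0 ?normr1.
have pT : pathwise \1_setT.
  have -> : [set: n.-tuple R] = box (fun=> setT) by apply/seteqP; split.
  by apply: pathwise_ray_box => j; left.
rewrite measurable_ray_boxes => mA.
pose Q : set_system (n.-tuple R) := fun A => pathwise \1_A.
suff : forall S, <<s ray_boxes R n >> S -> Q S by exact.
apply: dynkin_induction => //.
- exact: measurable_ray_boxes.
- exact: ray_boxesI.
- by move=> _ [B rB ->]; exact: pathwise_ray_box.
- move=> S mS pS; rewrite /Q.
  have -> : \1_(~` S) = (fun x => -1 * \1_S x + \1_setT x)%R
      :> (n.-tuple R -> R).
    apply/funext => x; rewrite !indicE in_setC in_setT mulN1r.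
    by case: (x \in S); rewrite /= ?addNr// oppr0 add0r.
  exact: pathwise_lin.
- move=> F mF tF pF; rewrite /Q.
  (* Disjointness keeps the partial sums equal to indicators, hence bounded by 1. *)
  have sumE k : (fun x => \sum_(i < k) \1_(F i) x)%R =
      \1_(\bigcup_(i in `I_k) F i) :> (n.-tuple R -> R).
    apply/funext => x; rewrite [RHS]indicE.
    have [[i ik ix]|xF] := pselect ((\bigcup_(i in `I_k) F i) x).
      rewrite mem_set; last by exists i.
      rewrite (bigD1 (Ordinal ik))//= indicE mem_set// big1 ?addr0//.
      move=> j ji; rewrite indicE memNset// => jx; move/eqP : ji; apply.
      by apply: val_inj; apply: (tF _ _ Logic.I Logic.I) => /=; exists x.
    rewrite memNset// big1// => i _; rewrite indicE memNset// => ix.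
    by apply: xF; exists (val i); first exact: ltn_ord.
  have cvgF x : (\sum_(i < k) \1_(F i) x)%R @[k --> \oo] -->
      (\1_(\bigcup_i F i) x : R).
    have [[i _ ix]|xF] := pselect ((\bigcup_i F i) x).
      apply: cvg_near_cst; exists i.+1 => // k /= ik.
      have -> := congr1 (@^~ x) (sumE k).
      by rewrite !indicE !mem_set//; exists i.
    apply: cvg_near_cst; apply: nearW => k.
    have -> := congr1 (@^~ x) (sumE k).
    rewrite !indicE !memNset// => -[i _ ix]; apply: xF; exists i => //.
  apply: (@pathwise_bounded_cvg (fun k x => \sum_(i < k) \1_(F i) x)%R) => //.
  + by move=> k; apply: pathwise_sum => i _; exact: pF.
  + by apply: measurable_indic; exact: bigcup_measurable.
  + by move=> k x; have -> := congr1 (@^~ x) (sumE k).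
  + by apply: nearW => x; exact: cvgF.
  + by move=> w; apply: nearW => x; exact: cvgF.
Qed.

(** Increasing simple functions approximate [f] in L^2 with [f] as dominating function, while
    monotone convergence handles [m w] without prior integrability. Integrability follows
    afterwards, the integral of [f] being the real number [I f w]. *)
Lemma pathwise_ge0 (f : n.-tuple R -> R) : f \in Lfun (leb T n) 2%:E ->
  (forall x, 0 <= f x)%R -> pathwise f.
Proof.
move=> Lf f0; split => //; have mf := mLfun Lf.
have mEf : measurable_fun setT (EFin \o f) by exact/measurable_EFinP.
pose u k : n.-tuple R -> R := nnsfun_approx measurableT mEf k.
have ndu : nondecreasing_seq u by exact: nd_nnsfun_approx.
have uf x : u k x @[k --> \oo] --> f x.
  suff /fine_cvgP[] : EFin \o u^~ x @ \oo --> (f x)%:E by [].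
  by apply: cvg_nnsfun_approx => // y _; rewrite lee_fin.
have u0 k x : (0 <= u k x)%R by exact: fun_ge0.
have ule k x : (u k x <= f x)%R.
  rewrite -(cvg_lim _ (uf x))//; apply: nondecreasing_cvgn_le.
    by move=> i j ij; exact/lefP/ndu.
  by apply/cvg_ex; exists (f x).
have mu k : measurable_fun setT (u k) by exact: measurable_funPT.
have pu k : pathwise (u k).
  pose g := nnsfun_approx measurableT mEf k.
  have -> : u k = _ := funext (fimfunEord g).
  apply: pathwise_sum => i _.
  under eq_fun do rewrite -[(_ * _)%R]addr0.
  by apply: pathwise_lin pathwise0; exact: pathwise_indic.
have If : {ae P, forall w, (I f w)%:E = \int[m w]_x (f x)%:E}.
  apply: (@pathwise_cvg u) => //.
    apply: (@dominated_Lnorm2 _ _ _ _ _ _ f) => //.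
    - by move=> k x; rewrite ger0_norm.
    - by move=> x; rewrite ger0_norm.
    - exact: nearW.
  apply: nearW => w.
  have := @cvg_monotone_convergence _ _ _ (m w) setT measurableT
    (fun k x => (u k x)%:E).
  rewrite (_ : (fun x => limn ((fun k x => (u k x)%:E)^~ x)) = EFin \o f).
    apply.
    + by move=> k; exact/measurable_EFinP.
    + by move=> k x _; rewrite lee_fin.
    + by move=> x _ i j ij; rewrite lee_fin; exact/lefP/ndu.
  apply/funext => x; apply/cvg_lim => //.
  by apply: cvg_EFin; [exact: nearW|exact: uf].
apply: filterS If => w ew; split => //; apply/integrableP; split => //.
under eq_integral do rewrite /= ger0_norm//.
by rewrite -ew ltry.
Qed.

Lemma pathwise_Lfun2 (f : n.-tuple R -> R) : f \in Lfun (leb T n) 2%:E ->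
  pathwise f.
Proof.
move=> Lf; have mf := mLfun Lf.
have part_Lfun2 (g : n.-tuple R -> R) : measurable_fun setT g ->
    (forall x, `|g x| = `|f x|)%R -> pathwise (fun x => Num.max (g x) 0%R).
  move=> mg gf; apply: pathwise_ge0; last by move=> x; rewrite le_max lexx orbT.
  apply: (le_Lfun2 _ _ Lf); first exact: measurable_maxr.
  by move=> x; rewrite -gf; case: (leP (g x) 0%R) => _; rewrite ?normr0.
have -> : f = (fun x => -1 * Num.max (- f x) 0 + Num.max (f x) 0)%R.
  apply/funext => x; case: (leP 0%R (f x)) => fx.
    by rewrite max_r ?oppr_le0// mulr0 add0r.
  by rewrite max_l ?oppr_ge0 1?ltW// mulN1r opprK addr0.
apply: pathwise_lin; apply: part_Lfun2 => //; last by move=> x; rewrite normrN.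
exact: measurable_funN.
Qed.

End pathwise_integral.

(** * The measure structure on the jump measure of a path *)

Section jump_measure_is_measure.
Context (R : realType) (x : R -> R) (tau : nat -> \bar R) (T : R) (n : nat)
  (r : 'I_n -> nat).

(* The proofs are arguments so that the measure structure can be inferred. *)
Definition path_measure of cadlag x &
    (forall s u : R, 0 <= s -> s <= u -> x s <= x u) :
    set (n.-tuple R) -> \bar R := jump_measure x tau T r.

Hypotheses (cx : cadlag x)
  (ndx : forall s u : R, 0 <= s -> s <= u -> x s <= x u).

Let path_measure0 : path_measure cx ndx set0 = 0%E.
Proof. by apply: esum1 => t _; rewrite measure0 mule0. Qed.

Let path_measure_ge0 A : (0 <= path_measure cx ndx A)%E.
Proof.
apply: esum_ge0 => t _; rewrite mule_ge0// lee_fin prodr_ge0// => j _.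
by rewrite exprn_ge0// jump_ge0.
Qed.

Let path_measure_sigma_additive : semi_sigma_additive (path_measure cx ndx).
Proof. exact: jump_measure_semi_sigma_additive. Qed.

HB.instance Definition _ := isMeasure.Build _ _ _ (path_measure cx ndx)
  path_measure0 path_measure_ge0 path_measure_sigma_additive.

End jump_measure_is_measure.

(** The coefficients single out the tuple [0, ..., n-1]. Its entries are distinct, so they vanish on
    tuples with a repetition, as elementary functions require. *)
Lemma elementary_box (R : realType) n (A : 'I_n -> set R) :
  elementary A (fun i => (i == ord_tuple n)%:R) = \1_(box A).
Proof.
apply/funext => x; rewrite /elementary (bigD1 (ord_tuple n))//= eqxx mul1r.
rewrite [X in _ + X]big1 ?addr0; last by move=> i it; rewrite (negPf it) mul0r.
by congr (\1_(box _) x); apply/funext => j; rewrite tnth_ord_tuple.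
Qed.

Lemma elementary_integral_box d (Omega : measurableType d) (R : realType) n
    (phi : nat -> set R -> Omega -> R) (r : 'I_n -> nat) (A : 'I_n -> set R) w :
  elementary_integral phi r A (fun i => (i == ord_tuple n)%:R) w =
  \prod_(j < n) phi (r j) (A j) w.
Proof.
rewrite /elementary_integral (bigD1 (ord_tuple n))//= eqxx mul1r.
rewrite [X in _ + X]big1 ?addr0; last by move=> i it; rewrite (negPf it) mul0r.
by apply: eq_bigr => j _; rewrite tnth_ord_tuple.
Qed.

(** * Application to the jump measures of the subordinator *)

Theorem proposition6p1 (R : realType) (d : measure_display)
    (Omega : measurableType d) (P : probability Omega R)
    (hP : measure_is_complete P)
    (X : R -> {RV P >-> R}) (hX : subordinator X)
    (hdrift : is_drift X 0) (hmom : moments_of_all_orders X)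
    (F : R -> set (set Omega)) (hF : filtration F) (hXF : adapted X F)
    (tau : nat -> Omega -> \bar R)
    (htau : forall k, stopping_time F (tau k))
    (hdisj : disjoint_graphs tau) (hexh : exhausts_jumps X tau)
    (T : R) (hT : 0 < T)
    (phi : nat -> set R -> Omega -> R)
    (hphi : forall k, (0 < k)%N -> jump_L2_measure X T k (phi k))
    (n : nat) (hn : (0 < n)%N)
    (r : 'I_n -> nat) (hr : forall j, (0 < r j)%N)
    (I : (n.-tuple R -> R) -> Omega -> R)
    (hI : multiple_ito_integral P T phi r I)
    (f : n.-tuple R -> R) (hf : f \in Lfun (leb T n) 2%:E) :
  {ae P, forall w, (I f w)%:E =
    (\int[jump_measure (X ^~ w) (tau ^~ w) T r]_(x in cube T n) (f x)%:E)%E}.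
Proof.
have cX w : cadlag (X ^~ w) := levy_cadlag (subordinator_levy hX) w.
have ndX w := subordinator_incr hX w.
pose m w : {measure set (n.-tuple R) -> \bar R} :=
  [the {measure set (n.-tuple R) -> \bar R} of
    path_measure (tau ^~ w) T r (cX w) (ndX w)].
have tau_jump w := (hexh w).1.
have jump_tau w := (hexh w).2.
(* Without drift, the sum of the jumps up to [T] is the real number [X T w]. *)
have jump_fin :
    {ae P, forall w, (\esum_(s in `]0%R, T]) (jump (X ^~ w) s)%:E < +oo)%E}.
  apply: filterS hdrift.2 => w /(_ T (ltW hT)).
  by rewrite mul0r add0e => <-; rewrite ltry.
have m_lty : {ae P, forall w, (m w setT < +oo)%E}.
  apply: filterS jump_fin => w jw.
  exact: (jump_measure_lty (cX w) (ndX w) (tau_jump w) jw hr).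
have mitv (a b : R) : measurable (`]a, b]%classic : set R).
  exact: measurable_itv.
have m_supp w : m w (~` box (fun _ : 'I_n => `]0%R, T]%classic)) = 0%E.
  apply: jump_measure_null => t tJ /=; apply.
  exact: (jump_tuples_box (tau_jump w)).
have m_off_diagonal w : {ae m w, forall t, off_diagonal T t}.
  apply: filterI.
    exists [set t : n.-tuple R | ~ uniq t]; split => //.
      exact: measurable_not_uniq.
    by apply: jump_measure_null => t [ut _] /=; apply.
  exists (~` box (fun _ : 'I_n => `]0%R, T]%classic)); split => //.
    by apply: measurableC; have [] := tuple_measure_box (leb1 T)
      (fun _ : 'I_n => mitv 0%R T).
  move=> t; apply: contra_not => tT j; have := tT j.
  by rewrite /= in_itv/= => /andP.
have box_pathwise (a b : 'I_n -> R) :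
    (forall j, [/\ 0 <= a j, a j <= b j & b j <= T]) ->
    (forall i j, i != j ->
      `]a i, b i]%classic `&` `]a j, b j]%classic = set0) ->
    pathwise P T I m \1_(box (fun j => `]a j, b j]%classic)).
  move=> ab disj; set A := fun j => `]a j, b j]%classic.
  have [mA _] := tuple_measure_box (leb1 T) (fun j => mitv (a j) (b j)).
  have m1 : measurable_fun setT (\1_(box A) : n.-tuple R -> R).
    exact: measurable_indic.
  split.
    apply: bounded1_Lfun2 => // x.
    by rewrite indicE; case: (_ \in _); rewrite ?normr0 ?normr1.
  have := ito_elementary hI (A := A) (a := fun i => (i == ord_tuple n)%:R).
  rewrite elementary_box => /(_ _ _ _ _) Ie.
  have {}Ie : I \1_(box A) =
      elementary_integral phi r A (fun i => (i == ord_tuple n)%:R) %[ae P].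
    apply: Ie.
    - by move=> j; exact: mitv.
    - move=> j; have [a0 _ bT] := ab j; apply: subset_itv; rewrite bnd_simp//.
    - move=> i j _ _ ij; apply/eqP/negPn/negP => /disj; rewrite -/(A i) -/(A j) => A0.
      by move: ij; rewrite A0 => -[].
    - move=> i; case: eqP => // ->; rewrite val_ord_tuple enum_uniq//.
  (* There are finitely many [j], so the exceptional null sets can be merged. *)
  have phiE : {ae P, forall w, forall j, phi (r j) (A j) w =
      power_jump X (r j) (b j) w - power_jump X (r j) (a j) w}.
    apply: filter_forall => j; have [a0 abj bT] := ab j.
    have := jump_L2_itv (hphi _ (hr j)) a0 abj bT.
    by apply: filterS => w /(_ Logic.I).
  near=> w.
  have jw : (\esum_(s in `]0%R, T]) (jump (X ^~ w) s)%:E < +oo)%E by near: w.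
  have mw : (m w setT < +oo)%E by near: w.
  have -> : I \1_(box A) w = \prod_(j < n) phi (r j) (A j) w.
    rewrite -elementary_integral_box.
    by (have : setT w by []); near: w.
  have phiw : forall j, phi (r j) (A j) w =
      power_jump X (r j) (b j) w - power_jump X (r j) (a j) w by near: w.
  (* Both sides equal the product over [j] of the increments of [power_jump X (r j)] on []a j, b
     j]]. *)
  have bE : m w (box A) = (\prod_(j < n) phi (r j) (A j) w)%:E.
    rewrite -prodEFin; under eq_bigr do rewrite phiw.
    rewrite (_ : m w _ = jump_measure (X ^~ w) (tau ^~ w) T r (box A))//.
    rewrite (jump_measure_box (cX w) (ndX w) (jump_tau w) jw hr)//.
      apply: eq_bigr => j _; have [a0 abj bT] := ab j.
      by rewrite (esum_jump_exp_itv (cX w) (ndX w) jw).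
    by move=> j; have [a0 _ bT] := ab j; apply: subset_itv; rewrite bnd_simp.
  split; last by rewrite integral_indic// setIT bE.
  apply/integrableP; split; first exact/measurable_EFinP.
  under eq_integral do rewrite /= ger0_norm//.
  by rewrite integral_indic// setIT bE ltry.
have [_ ] := pathwise_Lfun2 hI m_lty hT m_off_diagonal box_pathwise hf.
have [mcube _] := tuple_measure_box (leb1 T) (A := fun _ : 'I_n => `[0, T]%classic)
  (fun=> measurable_itv _).
apply: filterS => w [if_ ->].
(* The class [pathwise] integrates over the whole space; jump tuples lie in the cube, so its
   complement is null and can be removed. *)
rewrite (negligible_integral (measurableC mcube) measurableT if_).
  by rewrite setTD setCK.
apply: jump_measure_null => t tJ /=; apply => j.
have := jump_tuples_box (tau_jump w) tJ j.
by rewrite /= !in_itv/= => /andP[/ltW -> ->].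
Unshelve. all: by end_near. Qed.
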